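(* For every integer $l \ge 1$, the independent domination numbers of the fractal cubic networks satisfy $\gamma_i(FCN(l)) = 4\,\gamma_i(FCN(l-1)) - 2$.
   Context: Fractal cubic network: for an integer $l\ge 0$, $FCN(l)$ is the finite simple graph whose vertices are all binary strings of length $2l+2$, defined recursively as follows. $FCN(0)$ is the 4-cycle with vertices $00, 01, 11, 10$ in this cyclic order. For $l\ge 1$, $FCN(l)$ is obtained from the disjoint union of the four copies $ab\,\Vert\,FCN(l-1)$, $a,b\in\{0,1\}$ (each vertex string of $FCN(l-1)$ is prefixed by $ab$, adjacency inside a copy being that of $FCN(l-1)$), by adding the four edges $\{00w,10w\}$, $\{10w,11w\}$, $\{11w,01w\}$, $\{01w,00w\}$, where $w=10(01)^{l-1}$ is the string $10$ followed by $l-1$ repetitions of $01$. A dominating set of a graph $\Gamma$ is a set $D\subseteq V(\Gamma)$ such that every vertex of $\Gamma$ is in $D$ or adjacent to a vertex of $D$. It is an independent dominating set if moreover the induced subgraph $\Gamma[D]$ has no edges. $\gamma_i(\Gamma)$ is the minimum size of an independent dominating set. *)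

(* Defs.v *)
From HB Require Import structures.
From mathcomp Require Import all_boot.

Set Implicit Arguments.
Unset Strict Implicit.
Unset Printing Implicit Defensive.

Record sgraph := SGraph {
  vertex :> finType;
  adj : rel vertex;
  adj_sym : symmetric adj;
  adj_irrefl : irreflexive adj
}.
Arguments adj {s}.

Section Domination.
Variable G : sgraph.
Implicit Types D : {set G}.

Definition dominating D := [forall x, (x \in D) || [exists y in D, adj x y]].

Definition independent D := [forall x in D, forall y in D, ~~ adj x y].

Definition independent_dominating D := independent D && dominating D.

Lemma exists_independent_dominating : exists D, independent_dominating D.
Proof.
have ind0 : independent set0 by apply/forall_inP => x; rewrite inE.
have [D /maxsetP[indD maxD] _] := maxset_exists ind0.
exists D; rewrite /independent_dominating indD; apply/forallP => x.
apply: contraT; rewrite negb_or => /andP[xD /exists_inPn xN].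
suff ind : independent (x |: D).
  by rewrite -(maxD _ ind (subsetUr _ _)) setU11 in xD.
apply/forall_inP => y /setU1P yD; apply/forall_inP => z /setU1P zD.
case: yD zD => [->|yD] [->|zD].
- by rewrite adj_irrefl.
- exact: xN.
- by rewrite adj_sym xN.
- by move/forall_inP: indD => /(_ y yD)/forall_inP; apply.
Qed.

Lemma exists_independent_dominating_card :
  exists n, [exists D, independent_dominating D && (#|D| == n)].
Proof.
have [D PD] := exists_independent_dominating.
by exists #|D|; apply/existsP; exists D; rewrite PD eqxx.
Qed.

Definition gamma_i : nat := ex_minn exists_independent_dominating_card.

End Domination.

(* Bits are Booleans, with 0 = false and 1 = true; the list below is
   00, 01, 11, 10 in cyclic order. *)
Definition cycle4 : seq bitseq :=
  [:: [:: false; false]; [:: false; true]; [:: true; true]; [:: true; false]].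

Definition cycle4_adj : rel bitseq := fun x y =>
  [&& x \in cycle4, y \in cycle4 & (y == next cycle4 x) || (x == next cycle4 y)].

(* 10(01)^l, of length 2l + 2: the vertex at which the four copies of FCN(l)
   are linked in FCN(l+1). *)
Definition fcn_link (l : nat) : bitseq :=
  [:: true; false] ++ flatten (nseq l [:: false; true]).

Fixpoint fcn_adj (l : nat) : rel bitseq := fun x y =>
  if l is l'.+1 then
    (take 2 x == take 2 y) && fcn_adj l' (drop 2 x) (drop 2 y)
    || [&& cycle4_adj (take 2 x) (take 2 y),
           drop 2 x == fcn_link l' & drop 2 y == fcn_link l']
  else cycle4_adj x y.

Lemma cycle4_adj_sym : symmetric cycle4_adj.
Proof. by move=> x y; rewrite /cycle4_adj andbCA orbC. Qed.

Lemma cycle4_adj_irrefl : irreflexive cycle4_adj.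
Proof.
move=> x; rewrite /cycle4_adj orbb andbA andbb.
by apply/negbTE/negP => /andP[]; rewrite !inE; do 3!case/predU1P=> [->|] //;
  move/eqP=> ->.
Qed.

Lemma fcn_adj_sym l : symmetric (fcn_adj l).
Proof.
elim: l => [|l IH] x y /=; first exact: cycle4_adj_sym.
by rewrite eq_sym IH cycle4_adj_sym; congr (_ || (_ && _)); rewrite andbC.
Qed.

Lemma fcn_adj_irrefl l : irreflexive (fcn_adj l).
Proof.
elim: l => [|l IH] x /=; first exact: cycle4_adj_irrefl.
by rewrite IH cycle4_adj_irrefl andbF.
Qed.

Definition FCN (l : nat) : sgraph :=
  @SGraph ((2 * l + 2).-tuple bool) (fun x y => fcn_adj l x y)
    (fun x y => fcn_adj_sym l x y) (fun x => fcn_adj_irrefl l x).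

(* Main.v *)
Require Import Defs.
From mathcomp Require Import all_boot.
From mathcomp Require Import zify.

Set Implicit Arguments.
Unset Strict Implicit.
Unset Printing Implicit Defensive.

(** Let [a = gamma_i (FCN l)], and cut an independent dominating set of
    [FCN l.+1] into its four slices.  A slice is independent and dominates its
    copy except perhaps the link vertex, so it has at least [a - 1] elements,
    and at least [a] if it dominates the link vertex too.  Since the link
    vertices form a 4-cycle, at most two slices can fail to dominate their own
    link vertex; this gives the lower bound [4a - 2].

    For the upper bound, let [v] be the link vertex of [FCN l] and
    [x = (01)^(l+1)].  By induction, [FCN l] has an independent dominating set of
    size [a] through [v] and [x], and two independent sets of size [a - 1], one
    through [x] dominating exactly the vertices other than [v], and the other
    with [v] and [x] exchanged.  The link vertex of [FCN l.+1] is the copy of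
    [x] under the prefix 10, and [(01)^(l+2)] is the copy of [x] under 01.  As
    these two copies of [FCN l] are opposite in the 4-cycle, sets of the three
    kinds in the four copies can be assembled into such sets for [FCN l.+1]. *)

(** * Domination, exact or missing one vertex *)

Definition dominated (G : sgraph) (D : {set G}) (x : G) : bool :=
  (x \in D) || [exists y in D, adj x y].

(** The equality also forces [v] to be undominated, so [v] can be added to [D], or joined to a
    selected vertex of another copy, without losing independence. *)
Definition near_dominating (G : sgraph) (v : G) (D : {set G}) : Prop :=
  independent D /\ forall y, dominated D y = (y != v).

(** The size [n] is a parameter, so that such sets can be built before [n] is known to be
    [gamma_i G]. *)
Record tight_pair (G : sgraph) (v x : G) (n : nat) : Prop := TightPair {
  tight_full : exists D : {set G},
    [/\ independent_dominating D, v \in D, x \in D & #|D| = n];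
  tight_miss_l : exists D : {set G},
    [/\ near_dominating v D, x \in D & #|D|.+1 = n];
  tight_miss_r : exists D : {set G},
    [/\ near_dominating x D, v \in D & #|D|.+1 = n]
}.

Lemma independentP (G : sgraph) (D : {set G}) :
  reflect {in D &, forall x y, ~~ adj x y} (independent D).
Proof.
apply: (iffP forall_inP) => [ind x y xD yD | ind x xD].
  by have /forall_inP := ind x xD; apply.
by apply/forall_inP => y; apply: ind.
Qed.

Lemma gamma_i_leq (G : sgraph) (D : {set G}) :
  independent_dominating D -> gamma_i G <= #|D|.
Proof.
move=> iD; rewrite /gamma_i; case: ex_minnP => m _; apply.
by apply/existsP; exists D; rewrite iD eqxx.
Qed.

Lemma gamma_i_attained (G : sgraph) :
  exists2 D : {set G}, independent_dominating D & #|D| = gamma_i G.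
Proof.
rewrite /gamma_i; case: ex_minnP => m /existsP[D /andP[iD /eqP mD]] _.
by exists D.
Qed.

Lemma gamma_i_leq_near (G : sgraph) (v : G) (D : {set G}) :
  near_dominating v D -> gamma_i G <= #|D|.+1.
Proof.
move=> [/independentP indD domD].
have := domD v; rewrite eqxx => /negbT; rewrite negb_or => /andP[vD].
move=> /exists_inPn vN.
suff iD : independent_dominating (v |: D).
  by have := gamma_i_leq iD; rewrite cardsU1 vD.
apply/andP; split.
  apply/independentP => y z /setU1P[->|yD] /setU1P[->|zD].
  - by rewrite adj_irrefl.
  - exact: vN.
  - by rewrite adj_sym vN.
  - exact: indD.
apply/forallP => y; rewrite in_setU1.
have := domD y; case: eqVneq => //= _ /orP[-> //|].
case/exists_inP => z zD yz; apply/orP; right; apply/exists_inP.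
by exists z => //; rewrite inE zD orbT.
Qed.

(** * Four copies of a graph, linked in a 4-cycle *)

Section LinkedCopies.

Variables (G H : sgraph) (F : bool * bool * G -> H) (v : G).
Hypothesis F_bij : bijective F.
(** The Boolean inequality says that the prefixes differ in exactly one bit, that is, are adjacent
    in the 4-cycle. *)
Hypothesis adjF : forall c d x y, adj (F (c, x)) (F (d, y)) =
  (c == d) && adj x y || [&& (c.1 == d.1) != (c.2 == d.2), x == v & y == v].

Definition slice (D : {set H}) (c : bool * bool) : {set G} :=
  [set y | F (c, y) \in D].

Lemma slice_glue (E : bool * bool -> {set G}) :
  exists D, forall c, slice D c = E c.
Proof.
have [F' FK _] := F_bij.
exists [set h | (F' h).2 \in E (F' h).1] => c.
by apply/setP => y; rewrite !inE FK.
Qed.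

Lemma card_slice (D : {set H}) :
  #|D| = #|slice D (true, true)| + #|slice D (true, false)|
       + #|slice D (false, true)| + #|slice D (false, false)|.
Proof.
rewrite -sum1_card (reindex F) /=; last exact: onW_bij.
rewrite (eq_bigl (fun p => xpredT p.1 && (p.2 \in slice D p.1))); last first.
  by case=> c y; rewrite inE.
rewrite -(pair_big_dep xpredT (fun c y => y \in slice D c) (fun _ _ => 1)) /=.
rewrite (eq_bigr (fun p => #|slice D (p.1, p.2)|)); last first.
  by move=> [a b] _; rewrite sum1_card.
rewrite -(pair_bigA _ (fun a b => #|slice D (a, b)|)) /= !big_bool.
by rewrite /= addnA.
Qed.

Lemma independent_slice (D : {set H}) :
  independent D <->
  (forall c, independent (slice D c)) /\
  forall a b, ~~ ((v \in slice D (a, b)) &&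
                  ((v \in slice D (~~ a, b)) || (v \in slice D (a, ~~ b)))).
Proof.
split=> [/independentP ind | [indS indv]].
  split=> [c | a b].
    apply/independentP => x y; rewrite !inE => xD yD.
    by have := ind _ _ xD yD; rewrite adjF eqxx /= negb_or => /andP[].
  apply/negP => /andP[]; rewrite !inE => vD /orP[] /(ind _ _ vD);
    by rewrite adjF !eqxx /=; case: a b {vD} => [] [].
have [F' _ F'K] := F_bij.
apply/independentP => h k; rewrite -(F'K h) -(F'K k).
case: (F' h) (F' k) => [[a b] x] [[c d] y] hD kD.
rewrite adjF; apply/negP => /orP[/andP[/eqP[ac bd]]|].
  by subst c d; apply/negP/(independentP _ (indS (a, b))); rewrite inE.
case/and3P=> cyc /eqP xv /eqP yv; subst x y.
have := indv a b; rewrite !inE hD /=.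
by move: cyc kD {hD}; case: a b c d => [] [] [] [] //= _ -> //; rewrite orbT.
Qed.

Lemma dominated_slice (D : {set H}) a b y :
  dominated D (F ((a, b), y)) =
  dominated (slice D (a, b)) y ||
  (y == v) && ((v \in slice D (~~ a, b)) || (v \in slice D (a, ~~ b))).
Proof.
rewrite /dominated inE -orbA; congr (_ || _).
apply/exists_inP/orP => [[h] | [/exists_inP[z]|]].
- have [F' _ F'K] := F_bij; rewrite -(F'K h); case: (F' h) => [[c d] z] zD.
  rewrite adjF => /orP[/andP[/eqP[ac bd] yz]|].
    by subst c d; left; apply/exists_inP; exists z; rewrite ?inE.
  case/and3P=> cyc -> /eqP zv; subst z; right; rewrite !inE.
  by move: cyc zD; case: a b c d => [] [] [] [] //= _ -> //; rewrite orbT.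
- by rewrite inE => zD yz; exists (F ((a, b), z)); rewrite // adjF eqxx yz.
- case/andP => /eqP -> /orP[]; rewrite inE => vD;
    [exists (F ((~~ a, b), v)) | exists (F ((a, ~~ b), v))] => //;
    by rewrite adjF !eqxx /=; case: a b {vD} => [] [].
Qed.

Lemma gamma_i_linked_geq : 4 * gamma_i G <= gamma_i H + 2.
Proof.
have [D /andP[/independent_slice[indS indv] /forallP domD] <-] :=
  gamma_i_attained H.
have domS a b y : dominated (slice D (a, b)) y ||
  (y == v) && ((v \in slice D (~~ a, b)) || (v \in slice D (a, ~~ b))).
  by rewrite -dominated_slice; exact: domD.
have leS a b : gamma_i G <= #|slice D (a, b)| + ~~ dominated (slice D (a, b)) v.
  have [vdom | vundom] := boolP (dominated _ v).
    rewrite addn0; apply: gamma_i_leq; rewrite /independent_dominating indS.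
    apply/forallP => y; have := domS a b y.
    by case: eqVneq => [-> _ | _] /=; rewrite ?orbF.
  rewrite addn1; apply: (@gamma_i_leq_near _ v); split=> // y.
  have [-> | yv] := eqVneq y v; first exact: negbTE.
  by have := domS a b y; rewrite (negbTE yv) orbF.
have inS a b : v \in slice D (a, b) -> dominated (slice D (a, b)) v.
  by rewrite /dominated => ->.
(* If three slices failed, one of them would have both cyclic neighbours failing, hence no selected
   link vertex next to its own. *)
have le2 : ~~ dominated (slice D (true, true)) v
         + ~~ dominated (slice D (true, false)) v
         + ~~ dominated (slice D (false, true)) v
         + ~~ dominated (slice D (false, false)) v <= 2.
  move: (domS true true v) (domS true false v) (domS false true v)
    (domS false false v) (indv true true) (indv true false) (indv false true)
    (indv false false) (inS true true) (inS true false) (inS false true)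
    (inS false false); rewrite eqxx /=.
  do 4!case: (dominated _ v); do 4!case: (v \in _) => //=;
    by do ?[move=> /(_ isT)].
rewrite card_slice.
have := leS true true; have := leS true false.
have := leS false true; have := leS false false; lia.
Qed.

(* The link vertices of the copies 10 and 01 are selected; they dominate those
   of the copies 00 and 11. *)
Lemma glue_opposite (E10 E01 B : {set G}) :
  independent E10 -> independent E01 -> v \in E10 -> v \in E01 ->
  near_dominating v B ->
  exists D : {set H},
    [/\ independent D, slice D (true, false) = E10, slice D (false, true) = E01,
        #|D| = #|E10| + #|E01| + 2 * #|B| &
        forall a b y, dominated D (F ((a, b), y)) =
          (a == b) || dominated (if a then E10 else E01) y].
Proof.
move=> ind10 ind01 v10 v01 [indB domB].
have vB : v \notin B.
  by have := domB v; rewrite eqxx => /negbT; rewrite negb_or => /andP[].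
pose E (c : bool * bool) := if c.1 == c.2 then B else if c.1 then E10 else E01.
have [D sD] := slice_glue E; exists D; split; rewrite ?sD //.
- apply/independent_slice; split=> [[[] []] | [] []]; rewrite !sD //=;
    by rewrite /E /= ?(negbTE vB) ?andbF.
- by rewrite card_slice !sD /E /=; lia.
- move=> a b y; rewrite dominated_slice !sD.
  case: a b => [] []; rewrite /E /= ?domB ?v10 ?v01 ?(negbTE vB) ?andbF ?orbF //;
  by rewrite andbT orNb.
Qed.

(** Copies 00 and 11 receive [B], of size [n - 1]. With [A] in copies 10 and 01 the total is
    [4 * n - 2]; replacing one [A] by [C] saves one element and leaves only the [x] of that copy
    undominated. *)
Lemma tight_pair_linked (x : G) (n : nat) :
  tight_pair v x n ->
  tight_pair (F ((true, false), x)) (F ((false, true), x)) (4 * n - 2).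
Proof.
move=> [[A [iA vA xA nA]] [B [nB xB cB]] [C [[indC domC] vC cC]]].
have [indA /forallP domA] := andP iA.
have FE c d y z : (F (c, y) == F (d, z)) = (c == d) && (y == z).
  by rewrite (inj_eq (bij_inj F_bij)).
have [F' _ F'K] := F_bij.
split.
- have [D [indD s10 s01 cD domD]] := glue_opposite indA indA vA vA nB.
  exists D; split; last by lia.
  + rewrite /independent_dominating indD; apply/forallP => h.
    rewrite -(F'K h); case: (F' h) => [[a b] y].
    rewrite -[_ || _]/(dominated D _) domD if_same.
    by rewrite [dominated A y]domA orbT.
  + by have := xA; rewrite -s10 inE.
  + by have := xA; rewrite -s01 inE.
- have [D [indD s10 s01 cD domD]] := glue_opposite indC indA vC vA nB.
  exists D; split; last by lia.
  + split=> // h; rewrite -(F'K h); case: (F' h) => [[a b] y].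
    rewrite domD FE; case: a b => [] [] //=; exact: domA.
  + by have := xA; rewrite -s01 inE.
- have [D [indD s10 s01 cD domD]] := glue_opposite indA indC vA vC nB.
  exists D; split; last by lia.
  + split=> // h; rewrite -(F'K h); case: (F' h) => [[a b] y].
    rewrite domD FE; case: a b => [] [] //=; exact: domA.
  + by have := xA; rewrite -s10 inE.
Qed.

End LinkedCopies.

Lemma tight_pair_gamma_i_leq (G : sgraph) (v x : G) (n : nat) :
  tight_pair v x n -> gamma_i G <= n.
Proof. by case=> [[D [iD _ _ <-]] _ _]; apply: gamma_i_leq. Qed.

(** * Fractal cubic networks as linked copies *)

Lemma size_fcn_prefix l (p : bool * bool * (2 * l + 2).-tuple bool) :
  size [:: p.1.1, p.1.2 & p.2] == 2 * l.+1 + 2.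
Proof. by rewrite /= size_tuple; apply/eqP; lia. Qed.

Definition fcn_prefix l (p : bool * bool * FCN l) : FCN l.+1 :=
  Tuple (size_fcn_prefix p).

Lemma size_fcn_link l : size (fcn_link l) == 2 * l + 2.
Proof. by elim: l => //= l /eqP IH; apply/eqP; lia. Qed.

Definition fcn_link_vertex l : FCN l := Tuple (size_fcn_link l).

Lemma size_fcn_far l : size (flatten (nseq l.+1 [:: false; true])) == 2 * l + 2.
Proof. by elim: l => //= l /eqP IH; apply/eqP; lia. Qed.

Definition fcn_far_vertex l : FCN l := Tuple (size_fcn_far l).

Lemma fcn_prefix_bij l : bijective (@fcn_prefix l).
Proof.
(* The default of [insubd] is never taken, since [drop 2 t] has the right length. *)
pose G (t : FCN l.+1) : bool * bool * FCN l :=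
  ((nth false t 0, nth false t 1), insubd (fcn_link_vertex l) (drop 2 t)).
exists G => [[[a b] t] | t].
  by rewrite /G /= drop0; congr (_, _); apply: val_inj; rewrite insubdK //; exact: (valP t).
apply: val_inj => /=; rewrite insubdK.
  by case: t => -[|a [|b s]] //=; rewrite ?drop0 //; lia.
by rewrite unfold_in size_drop size_tuple; apply/eqP; lia.
Qed.

Lemma fcn_prefix_adj l c d (x y : FCN l) :
  adj (fcn_prefix (c, x)) (fcn_prefix (d, y)) =
  (c == d) && adj x y ||
  [&& (c.1 == d.1) != (c.2 == d.2), x == fcn_link_vertex l
    & y == fcn_link_vertex l].
Proof.
rewrite /adj /= !take0 !drop0 -!val_eqE /=.
by congr (_ && _ || _ && _); case: c d => [] [] [] [] [] [].
Qed.

(** The new link and far vertices differ only in their prefix: after it, both continue with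
    $(01)^{l+1}$. *)
Lemma fcn_link_vertexS l :
  fcn_link_vertex l.+1 = fcn_prefix ((true, false), fcn_far_vertex l).
Proof. exact: val_inj. Qed.

Lemma fcn_far_vertexS l :
  fcn_far_vertex l.+1 = fcn_prefix ((false, true), fcn_far_vertex l).
Proof. exact: val_inj. Qed.

(** * Base case: the 4-cycle *)

Lemma FCN0_vertexP (x : FCN 0) : exists a b, x = [tuple a; b].
Proof.
by case: x => [[|a [|b []]] // sz]; exists a, b; apply: val_inj.
Qed.

Lemma dominated_FCN0 (D : {set FCN 0}) (a b : bool) :
  dominated D [tuple a; b] =
  [|| [tuple a; b] \in D, [tuple ~~ a; b] \in D | [tuple a; ~~ b] \in D].
Proof.
rewrite /dominated; congr (_ || _); apply/exists_inP/orP => [[y yD] | []].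
- have [c [d yE]] := FCN0_vertexP y; subst y.
  by case: a b c d yD => [] [] [] [] //= h _; by [left | right].
- by move=> h; exists [tuple ~~ a; b] => //; case: a b {h} => [] [].
- by move=> h; exists [tuple a; ~~ b] => //; case: a b {h} => [] [].
Qed.

Lemma tight_pair_FCN0 :
  tight_pair (fcn_link_vertex 0) (fcn_far_vertex 0) (gamma_i (FCN 0)).
Proof.
have dom0 (D : {set FCN 0}) :
    (forall a b, dominated D [tuple a; b]) -> forall y, dominated D y.
  by move=> domD y; have [a [b ->]] := FCN0_vertexP y.
pose A : {set FCN 0} := [set fcn_link_vertex 0; fcn_far_vertex 0].
have cA : #|A| = 2 by rewrite cards2.
have iA : independent_dominating A.
  apply/andP; split.
    by apply/independentP => x y; rewrite !inE =>
      /orP[] /eqP-> /orP[] /eqP->.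
  apply/forallP; apply: dom0 => -[] []; rewrite dominated_FCN0 !inE //.
have -> : gamma_i (FCN 0) = 2.
  apply/eqP; rewrite eqn_leq -{1}cA gamma_i_leq //=.
  have [D /andP[_ /forallP domD] <-] := gamma_i_attained (FCN 0).
  rewrite ltnNge; apply/negP => /card_le1_eqP D1.
  (* A sole element of [D] cannot dominate its antipode, so [D] would be empty. *)
  have noD a b : [tuple a; b] \notin D.
    apply/negP => abD; have := domD [tuple ~~ a; ~~ b].
    rewrite -[_ || _]/(dominated D _) dominated_FCN0 !negbK.
    by case/or3P => /(D1 _ _ abD); case: a b {abD} => [] [].
  have := domD [tuple true; true].
  by rewrite -[_ || _]/(dominated D _) dominated_FCN0 !(negbTE (noD _ _)).
(* Distinct non-adjacent vertices of a 4-cycle are antipodal, so [y] dominates all but [x]. *)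
have near (x y : FCN 0) : adj x y = false -> x != y -> near_dominating x [set y].
  move=> xy nxy; split.
    by apply/independentP => ? ? /set1P-> /set1P->; rewrite adj_irrefl.
  move=> z; have [a [b xE]] := FCN0_vertexP x; have [c [d yE]] := FCN0_vertexP y.
  have [e [f ->]] := FCN0_vertexP z; subst x y.
  rewrite dominated_FCN0 !inE; move: xy nxy.
  by case: a b c d e f => [] [] [] [] [] [].
split.
- by exists A; split; rewrite ?inE ?eqxx ?orbT.
- by exists [set fcn_far_vertex 0]; split; rewrite ?cards1 ?inE //; apply: near.
- by exists [set fcn_link_vertex 0]; split; rewrite ?cards1 ?inE //; apply: near.
Qed.

(** * The recursion *)

Lemma gamma_i_FCNS_tight l :
  tight_pair (fcn_link_vertex l) (fcn_far_vertex l) (gamma_i (FCN l)) ->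
  tight_pair (fcn_link_vertex l.+1) (fcn_far_vertex l.+1)
    (4 * gamma_i (FCN l) - 2) /\
  gamma_i (FCN l.+1) = 4 * gamma_i (FCN l) - 2.
Proof.
move=> tl; have tSl : tight_pair (fcn_link_vertex l.+1) (fcn_far_vertex l.+1)
    (4 * gamma_i (FCN l) - 2).
  rewrite fcn_link_vertexS fcn_far_vertexS.
  exact: (tight_pair_linked (@fcn_prefix_bij l) (@fcn_prefix_adj l)).
split=> //; have := tight_pair_gamma_i_leq tSl.
have := gamma_i_linked_geq (@fcn_prefix_bij l) (@fcn_prefix_adj l); lia.
Qed.

(** The value of [gamma_i (FCN l.+1)] is established along with its tight pair, which lets the
    induction go on with the minimum size. *)
Lemma tight_pair_FCN l :
  tight_pair (fcn_link_vertex l) (fcn_far_vertex l) (gamma_i (FCN l)).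
Proof.
elim: l => [|l /gamma_i_FCNS_tight[tSl ->] //]; exact: tight_pair_FCN0.
Qed.

Theorem corollary1 (l : nat) (hl : 1 <= l) :
  gamma_i (FCN l) = 4 * gamma_i (FCN (l - 1)) - 2.
Proof.
case: l hl => // l _; rewrite subn1.
by have [] := gamma_i_FCNS_tight (tight_pair_FCN l).
Qed.
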